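(* Let $n,p\ge 1$ be integers, let $g:\mathbb{R}^n\to\mathbb{R}^p$ be differentiable, let $C(x)=\frac{\partial g^{\mathsf T}}{\partial x}\big|_x\in\mathbb{R}^{n\times p}$, and let $z(t)\in\mathbb{R}^p$ satisfy $z(t+1)=Az(t)$ for integers $t\ge 0$, with $A\in\mathbb{R}^{p\times p}$. Let $N_0=2p-2$, let $N\ge N_0+1$ be an integer, and let $x(0),\dots,x(N)\in\mathbb{R}^n$ be the evaluation points; write $C(t)=C(x(t))$. Assume: (A1) $A$ has distinct and non-zero eigenvalues; (A2) the pair $(A,z(0))$ is controllable; (A3) the pair $(A,C(x_0))$ is observable; (A4) $x(t)=x_0$ for all $0\le t\le N_0$, for some $x_0\in\mathbb{R}^n$. Let $T\in\mathbb{R}^{p\times p}$ be the invertible matrix and $\overline z(t)=Tz(t)$ the transformed parameters defined in the context, and let $$M=\begin{bmatrix}\overline z(N_0+1)^{\mathsf T}\otimes C(N_0+1)\\ \vdots\\ \overline z(N)^{\mathsf T}\otimes C(N)\end{bmatrix}\in\mathbb{R}^{n(N-N_0)\times p^2}.$$ Then $M$ has full column rank only if the matrix $$\begin{bmatrix}C(N_0+1)^{\mathsf T}&\cdots&C(N)^{\mathsf T}\end{bmatrix}^{\mathsf T}\in\mathbb{R}^{n(N-N_0)\times p}$$ has full rank.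
   Context: Setting: the cost $f(x,z(t))=g(x)^{\mathsf T}z(t)$ has gradient $y(x,t)=C(x)z(t)$ with respect to $x$, where $C(x)\in\mathbb{R}^{n\times p}$ has $(i,j)$ entry $\partial g_j/\partial x_i(x)$. The measurements are $y(t)=C(x(t))z(t)$, $t=0,\dots,N$. Controllability of $(A,z(0))$ means that $Z(0)=[z(0)\ Az(0)\ \cdots\ A^{p-1}z(0)]$ is invertible. Observability of $(A,C(x_0))$ means that the observability matrix $O(x_0)$, obtained by stacking $C(x_0),C(x_0)A,\dots,C(x_0)A^{p-1}$, has full column rank $p$. Definition of $T$ and $\overline z$: let $Y_{\mathrm h}$ be the block Hankel matrix with $p$ block rows and $p$ columns whose $(i,j)$ block is $y(i+j-2)$, $1\le i,j\le p$; then $Y_{\mathrm h}=O(x_0)Z(0)$ has rank $p$. From a singular value decomposition of $Y_{\mathrm h}$, let $\overline U\in\mathbb{R}^{np\times p}$ be the matrix of left singular vectors corresponding to the non-zero singular values. Since $\overline U$ and $O(x_0)$ have the same column space, there is a unique invertible $T\in\mathbb{R}^{p\times p}$ with $O(x_0)T^{-1}=\overline U$. Set $\overline z(t)=Tz(t)$ for all $t\ge 0$. $\otimes$ denotes the Kronecker product. *)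

(* Defs.v *)
From HB Require Import structures.
From mathcomp Require Import all_boot all_order all_algebra.
From mathcomp Require Import complex mxtens.
From mathcomp Require Import all_classical all_reals all_analysis.

Set Implicit Arguments.
Unset Strict Implicit.
Unset Printing Implicit Defensive.

Import Order.TTheory GRing.Theory Num.Theory.
Import numFieldNormedType.Exports.
Local Open Scope ring_scope.

(* The gradient of g(x)^T z with respect to x is grad_mx g x *m z. *)
Definition grad_mx (R : realType) (n p : nat) (g : 'cV[R]_n -> 'cV[R]_p)
    (x : 'cV[R]_n) : 'M[R]_(n, p) :=
  \matrix_(i < n, j < p) 'D_(delta_mx i 0) (fun u : 'cV[R]_n => g u j 0) x.

(* The spectrum of a real matrix is its spectrum over the complex numbers. *)
Definition distinct_nonzero_eigenvalues (R : realType) (p : nat)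
    (A : 'M[R]_p) : Prop :=
  exists s : p.-tuple R[i],
    [/\ uniq s,
        forall a : R[i],
          eigenvalue (map_mx (real_complex R) A) a = (a \in s)
      & 0 \notin s].

Definition ctrb_mx (R : realType) (p : nat) (A : 'M[R]_p) (b : 'cV[R]_p) :
    'M[R]_p :=
  \matrix_(i < p, j < p) (A ^+ j *m b) i 0.

Definition controllable (R : realType) (p : nat) (A : 'M[R]_p)
    (b : 'cV[R]_p) : Prop :=
  ctrb_mx A b \in unitmx.

Definition obsv_mx (R : realType) (n p : nat) (A : 'M[R]_p)
    (C : 'M[R]_(n, p)) : 'M[R]_(\sum_(k < p) n, p) :=
  \mxcol_(k < p) (C *m A ^+ k).

Definition full_col_rank (R : realType) (m n : nat) (A : 'M[R]_(m, n)) : Prop :=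
  \rank A = n.

Definition full_rank (R : realType) (m n : nat) (A : 'M[R]_(m, n)) : Prop :=
  \rank A = minn m n.

Definition observable (R : realType) (n p : nat) (A : 'M[R]_p)
    (C : 'M[R]_(n, p)) : Prop :=
  full_col_rank (obsv_mx A C).

(* With indices starting at 0, block (i, j) is y (i + j). *)
Definition block_hankel (R : realType) (n p : nat) (y : nat -> 'cV[R]_n) :
    'M[R]_(\sum_(i < p) n, p) :=
  \mxcol_(i < p) \matrix_(r < n, j < p) y (i + j)%N r 0.

(* Full singular value decomposition Y = U S V^T; the diagonal of S is not
   required to be sorted. *)
Definition is_svd (R : realType) (m n : nat) (Y : 'M[R]_(m, n))
    (U : 'M[R]_m) (S : 'M[R]_(m, n)) (V : 'M[R]_n) : Prop :=
  [/\ U^T *m U = 1%:M,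
      V^T *m V = 1%:M,
      forall (i : 'I_m) (j : 'I_n), i <> j :> nat -> S i j = 0,
      forall (i : 'I_m) (j : 'I_n), 0 <= S i j
    & Y = U *m S *m V^T].

(* W consists, in order, of exactly those columns of U whose index carries a
   non-zero diagonal entry of S. *)
Definition nonzero_left_singular (R : realType) (m n r : nat)
    (U : 'M[R]_m) (S : 'M[R]_(m, n)) (W : 'M[R]_(m, r)) : Prop :=
  exists f : 'I_r -> 'I_m,
    [/\ forall k l : 'I_r, (k < l)%N -> (f k < f l)%N,
        forall i : 'I_m,
          (exists k : 'I_r, f k = i) <->
          (exists j : 'I_n, i = j :> nat /\ S i j <> 0)
      & W = colsub f U].

(* The possible matrices T, one for each singular value decomposition of the
   Hankel matrix of the measurements y. *)
Definition is_transform (R : realType) (n p : nat) (A : 'M[R]_p)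
    (C0 : 'M[R]_(n, p)) (y : nat -> 'cV[R]_n) (T : 'M[R]_p) : Prop :=
  exists (U : 'M[R]_(\sum_(i < p) n)) (S : 'M[R]_(\sum_(i < p) n, p))
         (V : 'M[R]_p) (W : 'M[R]_(\sum_(i < p) n, p)),
    [/\ is_svd (block_hankel p y) U S V,
        nonzero_left_singular U S W,
        T \in unitmx
      & obsv_mx A C0 *m invmx T = W].

(* Main.v *)
Require Import Defs.
From HB Require Import structures.
From mathcomp Require Import all_boot all_order all_algebra.
From mathcomp Require Import complex mxtens.
From mathcomp Require Import all_classical all_reals all_analysis.

Set Implicit Arguments.
Unset Strict Implicit.
Unset Printing Implicit Defensive.

Import Order.TTheory GRing.Theory Num.Theory.
Import numFieldNormedType.Exports.
Local Open Scope ring_scope.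

(** A common kernel vector [v] of all the [C k] gives kernel vectors of the stacked Kronecker
    products: by the mixed-product rule [(D k *t C k) *m (w *t v) = (D k *m w) *t (C k *m v) = 0]
    for every [w]. So injectivity of the large stack forces injectivity of the stack of the [C k];
    the theorem takes the transformed parameters as the row factors [D k]. *)

(* A kernel V of the stacked C k yields the kernel 1 *t V of the stacked
   D k *t C k, which vanishes only if V does because q is positive. *)
Lemma row_full_mxcol_tensmx (F : fieldType) (r q p : nat) (m_ n_ : 'I_r -> nat)
    (D : forall k, 'M[F]_(m_ k, q)) (C : forall k, 'M[F]_(n_ k, p)) :
  (0 < q)%N -> row_full (\mxcol_k (D k *t C k)) -> row_full (\mxcol_k C k).
Proof.
move=> q_gt0 fullM; rewrite -cokermx_eq0.
set V := cokermx _.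
have CV0 : forall k, C k *m V = 0.
  by apply/eq_mxcolP; rewrite -mxcol_mul mulmx_coker mxcol0.
have tV0 : (1%:M : 'M[F]_q) *t V = 0.
  apply: (row_full_inj fullM); rewrite mulmx0 mxcol_mul -[RHS]mxcol0.
  by apply: eq_mxcol => k; rewrite tensmx_mul CV0 tensmx0.
(* The diagonal block [(o, o)] of [1%:M *t V] is [V] itself; [q_gt0] supplies the index [o]. *)
apply/eqP/matrixP => i j; pose o := Ordinal q_gt0.
have /matrixP/(_ (mxtens_index (o, i)) (mxtens_index (o, j))) := tV0.
by rewrite tensmxE !mxE eqxx mul1r.
Qed.

Theorem mainTheorem1 (R : realType) (n p : nat) (hn : (1 <= n)%N)
    (hp : (1 <= p)%N)
    (g : 'cV[R]_n -> 'cV[R]_p)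
    (hg : forall u : 'cV[R]_n, differentiable g u)
    (A : 'M[R]_p) (z : nat -> 'cV[R]_p)
    (hz : forall t : nat, z t.+1 = A *m z t)
    (N0 N : nat) (hN0 : N0 = (2 * p - 2)%N) (hN : (N0 + 1 <= N)%N)
    (x : nat -> 'cV[R]_n) (x0 : 'cV[R]_n)
    (A1 : distinct_nonzero_eigenvalues A)
    (A2 : controllable A (z 0%N))
    (A3 : observable A (grad_mx g x0))
    (A4 : forall t : nat, (t <= N0)%N -> x t = x0)
    (T : 'M[R]_p)
    (hT : is_transform A (grad_mx g x0)
            (fun t : nat => grad_mx g (x t) *m z t) T) :
  full_col_rank
    (\mxcol_(k < N - N0)
       ((T *m z (N0 + 1 + k)%N)^T *t grad_mx g (x (N0 + 1 + k)%N))) ->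
  full_rank (\mxcol_(k < N - N0) grad_mx g (x (N0 + 1 + k)%N)).
Proof.
move=> rkM; rewrite /full_rank.
suff /eqP rkC : row_full (\mxcol_(k < N - N0) grad_mx g (x (N0 + 1 + k)%N)).
  (* Rank [p] is bounded by the number of rows, so the minimum in [full_rank] is [p]. *)
  by rewrite rkC; apply/esym/minn_idPr; rewrite -{1}rkC rank_leq_row.
by apply: row_full_mxcol_tensmx hp _; apply/eqP; exact: rkM.
Qed.
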